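(* Let $\mathcal{H}$ be a complex Hilbert space and let $S,T\in\mathcal{L}(\mathcal{H})$ be split operators such that $\|P_{S^*}(I-ST)\|<1$. Then: (1) if $S\overset{*}{\leq}T$, then the group proper splitting of $S$ converges; (2) if $S\overset{\sharp}{\leq}T$, then the group proper splitting of $S$ converges.
   Context: $S\in\mathcal{L}(\mathcal{H})$ is a split operator if it has closed range and $\mathcal{R}(S)\dotplus\mathcal{N}(S)=\mathcal{H}$ (direct sum). For such $S$, the group inverse $S^\sharp\in\mathcal{L}(\mathcal{H})$ is the unique operator $X$ with $SXS=S$, $XSX=X$, $SX=XS$. $P_{S^*}$ is the orthogonal projection onto $\mathcal{R}(S^* )$. A proper splitting of a closed range operator $S$ is a decomposition $S=U-W$ with $\mathcal{R}(U)=\mathcal{R}(S)$ and $\mathcal{N}(U)=\mathcal{N}(S)$; it converges if $\rho(U^\dagger W)<1$, where $\rho$ is the spectral radius and $U^\dagger$ the Moore-Penrose inverse. The group proper splitting of a split operator $S$ is $S=S^\sharp-W$, i.e. $W=S^\sharp-S$. Star order: $S\overset{*}{\leq}T$ if there exist orthogonal projections $P,Q$ with $S=PT$ and $S^*=QT^*$ (one may choose $P,Q$ to be the orthogonal projections onto $\overline{\mathcal{R}(S)}$ and $\overline{\mathcal{R}(S^* )}$). Sharp order: $S\overset{\sharp}{\leq}T$ if $S=T$ or there exists a bounded idempotent $Q$ with $\mathcal{R}(Q)=\mathcal{R}(S)$, $\mathcal{N}(Q)=\mathcal{N}(S)$ and $S=QT=TQ$. *)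

(* Defs.v *)
From mathcomp Require Import all_boot all_order all_algebra.
From mathcomp Require Import complex.
From mathcomp Require Import all_classical all_reals all_analysis.

Set Implicit Arguments.
Unset Strict Implicit.
Unset Printing Implicit Defensive.

Import Order.TTheory GRing.Theory Num.Theory.
Import numFieldNormedType.Exports.

Local Open Scope classical_set_scope.
Local Open Scope ring_scope.
Local Open Scope complex_scope.

(* Complex Hilbert spaces are complete normed spaces over R[i] together with a
   positive definite Hermitian form (linear in its first argument) inducing the
   norm. Operators are plain functions, and membership in L(H) is the predicate
   [bounded_operator].

   The adjoint, orthogonal projections, group inverse and Moore-Penrose inverse
   are selected with [xget] from the set of operators that satisfy their
   defining property; that set always has at most one element. The default 0 is
   returned only when the object does not exist in L(H), e.g. when S is not a
   split operator in the case of [group_inverse S]. *)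

Definition hilbert_norm (R : realType) (H : completeNormedModType R[i])
    (ip : {dot H for Num.conj}) : Prop :=
  forall x : H, ip x x = `|x| ^+ 2.

Section operators.
Variables (R : realType) (H : completeNormedModType R[i]).
Implicit Types (A Q S U W X : H -> H).

Definition bounded_operator A : Prop := linear A /\ continuous A.

Definition kernel A : set H := [set x | A x = 0].

(* The norm of H takes its values in R[i]; Re turns it into an element of R. *)
Definition operator_norm A : \bar R :=
  ereal_sup [set (complex.Re `|A x|)%:E | x in [set x : H | `|x| <= 1]].

Definition spectrum A : set R[i] :=
  [set l | ~ exists B : H -> H, [/\ bounded_operator B,
     forall x, B (A x - l *: x) = x &
     forall x, A (B x) - l *: B x = x]].

(* If H = 0 the spectrum is empty and the value is -oo. *)
Definition spectral_radius A : \bar R :=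
  ereal_sup [set (complex.Re `|l|)%:E | l in spectrum A].

Definition idempotent_operator Q : Prop :=
  bounded_operator Q /\ Q \o Q = Q.

Definition split_operator S : Prop :=
  [/\ bounded_operator S,
      closed (range S),
      (forall x, exists u v, [/\ range S u, kernel S v & x = u + v]) &
      range S `&` kernel S = [set 0]].

Definition is_group_inverse S X : Prop :=
  [/\ bounded_operator X, S \o X \o S = S, X \o S \o X = X & S \o X = X \o S].

Definition group_inverse S : H -> H := xget (cst 0) [set X | is_group_inverse S X].

Definition proper_splitting S U W : Prop :=
  [/\ bounded_operator U, bounded_operator W, S = U \- W,
      range U = range S & kernel U = kernel S].

Definition sharp_le S T : Prop :=
  S = T \/ exists Q, [/\ idempotent_operator Q, range Q = range S,
                         kernel Q = kernel S, S = Q \o T & S = T \o Q].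

Section inner_product.
Variable ip : {dot H for Num.conj}.

Definition is_adjoint A B : Prop :=
  bounded_operator B /\ forall x y, ip (A x) y = ip x (B y).

Definition adjoint A : H -> H := xget (cst 0) [set B | is_adjoint A B].

Definition selfadjoint A : Prop := is_adjoint A A.

Definition orthogonal_projection P : Prop :=
  idempotent_operator P /\ selfadjoint P.

Definition orth_proj (V : set H) : H -> H :=
  xget (cst 0) [set P | orthogonal_projection P /\ range P = V].

Definition is_moore_penrose A X : Prop :=
  [/\ bounded_operator X, A \o X \o A = A, X \o A \o X = X,
      selfadjoint (A \o X) & selfadjoint (X \o A)].

Definition moore_penrose A : H -> H := xget (cst 0) [set X | is_moore_penrose A X].

Definition convergent_proper_splitting S U W : Prop :=
  proper_splitting S U W /\ (spectral_radius (moore_penrose U \o W) < 1)%E.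

Definition group_proper_splitting_converges S : Prop :=
  convergent_proper_splitting S (group_inverse S) (group_inverse S \- S).

Definition star_le S T : Prop :=
  exists P Q, [/\ orthogonal_projection P, orthogonal_projection Q,
                  S = P \o T & adjoint S = Q \o adjoint T].

End inner_product.
End operators.

(* Main.v *)
Require Import Defs.
From mathcomp Require Import all_boot all_order all_algebra.
From mathcomp Require Import complex ring lra.
From mathcomp Require Import all_classical all_reals all_analysis.
Import Order.TTheory GRing.Theory Num.Theory.
Import numFieldNormedType.Exports.
Local Open Scope classical_set_scope.
Local Open Scope ring_scope.
Local Open Scope complex_scope.

(* Let U be the group inverse of S, W = U - S and P the orthogonal projection
   onto R(S^* ). Since N(U) = N(S), U^+ U is the orthogonal projection along N(S),
   that is P, and S = U S^2 then gives U^+ W = P - P S^2. So it suffices that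
   P - P S^2 be a strict contraction. If S <=# T then S T = S^2, and this operator
   is P (I - S T). If S <=* T then S = T P, and it is P (I - S T) P.

   The inverses exist because the adjoint of a closed range operator S is
   bounded below on R(S): with P_S the projection onto R(S), the operator
   S S^* + (I - P_S) is then coercive, hence invertible with some inverse D, and
   S^+ = S^* D. *)

(** * Real-valued norm and completeness *)

Lemma geometric_small (R : realType) (C q e : R) :
  0 <= q < 1 -> 0 < e -> exists n, C * q ^+ n < e.
Proof.
move=> /andP[q0 q1] e0.
have : (fun n => C * q ^+ n) @ \oo --> (0 : R).
  by apply: cvg_geometric; rewrite ger0_norm.
move=> /cvgrPdist_lt /(_ e e0) [n _ /(_ n (leqnn n))] /=.
rewrite sub0r normrN => h; exists n; exact: le_lt_trans (ler_norm _) h.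
Qed.

(** Passes an inequality to the limit: if [b < a], the geometric error would eventually drop below
    [a - b]. *)
Lemma geometric_le (R : realType) (C q a b : R) :
  0 <= q < 1 -> (forall n, a <= b + C * q ^+ n) -> a <= b.
Proof.
move=> q01 h; rewrite leNgt; apply/negP => ba.
have [|n] := @geometric_small R C q (a - b) q01; first by rewrite subr_gt0.
by rewrite ltrBrDl ltNge h.
Qed.

Section real_norm.
Set Implicit Arguments.
Unset Strict Implicit.
Context {R : realType} {H : completeNormedModType R[i]}.
Implicit Types (x y z : H) (A B : H -> H).

(** The norm of [H] lies in [R[i]], which is only partially ordered; estimates are carried out in
    [R], where the order is total. *)
Definition rnorm x : R := complex.Re `|x|.

Lemma normE x : `|x| = (rnorm x)%:C.
Proof. by rewrite /rnorm RRe_real. Qed.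

Lemma rnorm_ge0 x : 0 <= rnorm x.
Proof. by rewrite -ler0c -normE. Qed.

Lemma rnorm_eq0 x : rnorm x = 0 -> x = 0.
Proof. by move=> x0; apply/eqP; rewrite -normr_eq0 normE x0. Qed.

Lemma rnorm0 : rnorm 0 = 0.
Proof. by rewrite /rnorm normr0. Qed.

Lemma ler_rnormD x y : rnorm (x + y) <= rnorm x + rnorm y.
Proof. by rewrite -lecR rmorphD /= -!normE ler_normD. Qed.

Lemma rdistC x y : rnorm (x - y) = rnorm (y - x).
Proof. by rewrite /rnorm distrC. Qed.

Lemma rnormN x : rnorm (- x) = rnorm x.
Proof. by rewrite /rnorm normrN. Qed.

Lemma rnormZ (a : R[i]) x : rnorm (a *: x) = complex.Re `|a| * rnorm x.
Proof.
apply: complexI; rewrite rmorphM /= -!normE normrZ; congr (_ * _).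
Qed.

Lemma rnormZr (t : R) x : rnorm (t%:C *: x) = `|t| * rnorm x.
Proof. by rewrite rnormZ normc_def /= expr0n /= addr0 sqrtr_sqr. Qed.

Lemma ler_rdistD z x y : rnorm (x - y) <= rnorm (x - z) + rnorm (z - y).
Proof. by apply: le_trans (ler_rnormD _ _); rewrite addrA subrK. Qed.

Lemma rnorm_nbhs z (P : set H) :
  nbhs z P <-> exists2 e : R, 0 < e & forall y, rnorm (z - y) < e -> P y.
Proof.
split=> [/nbhs_normP[e /= e0 eP]|[e e0 eP]].
  have e_real : (complex.Re e)%:C = e by rewrite RRe_real ?gtr0_real.
  exists (complex.Re e); first by rewrite -ltcR e_real.
  by move=> y zy; apply: eP => /=; rewrite normE -e_real ltcR.
apply/nbhs_normP; exists e%:C; first by rewrite /= ltcR.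
by move=> y /=; rewrite normE ltcR; exact: eP.
Qed.

(** Completeness of [H] enters here. The explicit rate lets later arguments work with inequalities
    instead of limits. *)
Lemma geometric_limit (u : nat -> H) (C q : R) : 0 <= q < 1 ->
  (forall n, rnorm (u n.+1 - u n) <= C * q ^+ n) ->
  exists l, forall n, rnorm (l - u n) <= C / (1 - q) * q ^+ n.
Proof.
move=> q01 du; have /andP[q0 q1] := q01; set K := C / (1 - q).
have C0 : 0 <= C by have := du 0%N; rewrite expr0 mulr1; apply: le_trans (rnorm_ge0 _).
have K0 : 0 <= K by rewrite /K divr_ge0// subr_ge0 ltW.
have CK : C = K * (1 - q) by rewrite /K divfK// subr_eq0 gt_eqF.
have dist n m : rnorm (u (n + m)%N - u n) <= K * q ^+ n.
  (* As [C = K * (1 - q)], the increment at [n] is at most [K * (q ^+ n - q ^+ n.+1)], so this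
     sharper bound telescopes. *)
  suff : rnorm (u (n + m)%N - u n) <= K * (q ^+ n - q ^+ (n + m)).
    move/le_trans; apply; rewrite ler_wpM2l// gerBl exprn_ge0//.
  elim: m => [|m IH]; first by rewrite addn0 !subrr mulr0 rnorm0.
  rewrite addnS; apply: le_trans (ler_rdistD (u (n + m)%N) _ _) _.
  apply: le_trans (lerD (du _) IH) _.
  by rewrite exprS CK le_eqVlt; apply/orP; left; apply/eqP; ring.
have : cvgn u.
  apply/cauchy_cvgP; apply/cauchy_ballP => e e0.
  have e_real : (complex.Re e)%:C = e by rewrite RRe_real ?gtr0_real.
  have e0' : 0 < complex.Re e / 2 by rewrite divr_gt0 // -ltcR e_real.
  have [n0 n0P] := @geometric_small R K q _ q01 e0'.
  have un0 n : (n0 <= n)%N -> rnorm (u n - u n0) < complex.Re e / 2.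
    by move=> /subnKC <-; exact: le_lt_trans (dist _ _) n0P.
  pose B := [set y : H | rnorm (y - u n0) < complex.Re e / 2].
  exists (B, B); first by split; exists n0.
  move=> [x y] [/= hx hy]; rewrite -ball_normE /= normE -e_real ltcR.
  apply: le_lt_trans (ler_rdistD (u n0) _ _) _.
  by rewrite (splitr (complex.Re e)) ltrD// rdistC.
move=> /cvg_ex[l ul]; exists l => n.
apply/ler_addgt0Pr => e e0.
have : nbhs l [set y | rnorm (l - y) < e] by apply/rnorm_nbhs; exists e.
move/ul => [m _ /(_ (n + m)%N (leq_addl _ _))] /= lu.
apply: le_trans (ler_rdistD (u (n + m)%N) _ _) _.
by rewrite addrC lerD// ltW.
Qed.

Lemma contraction_fixpoint (F : H -> H) (q : R) : 0 <= q < 1 ->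
  (forall x y, rnorm (F x - F y) <= q * rnorm (x - y)) -> exists p, F p = p.
Proof.
move=> q01 lipF; have /andP[q0 q1] := q01.
pose u n := iter n F 0.
have [|p pP] := @geometric_limit u (rnorm (F 0)) q q01.
  elim=> [|n IH]; first by rewrite /u /= subr0 expr0 mulr1.
  by rewrite exprS mulrCA; apply: le_trans (lipF _ _) _; rewrite ler_wpM2l.
set K := _ / _ in pP.
exists p; apply/eqP; rewrite -subr_eq0; apply/eqP/rnorm_eq0/le_anti.
(* The iterate [u n.+1] is within [q * K * q ^+ n] of [F p] and within [K * q ^+ n.+1] of [p], hence
   the constant [2 * q * K]. *)
rewrite rnorm_ge0 andbT; apply: (@geometric_le R (2 * q * K) q) => // n.
rewrite add0r; apply: le_trans (ler_rdistD (u n.+1) _ _) _.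
have -> : 2 * q * K * q ^+ n = q * (K * q ^+ n) + K * q ^+ n.+1 by rewrite exprS; ring.
apply: lerD; last by rewrite rdistC; exact: pP.
by apply: le_trans (lipF _ _) _; apply: ler_wpM2l (pP n).
Qed.

Definition approx_closed (M : set H) : Prop :=
  forall l, (forall e, 0 < e -> exists2 m, M m & rnorm (l - m) < e) -> M l.

Lemma closed_approx (M : set H) : closed M -> approx_closed M.
Proof.
move=> clM l lM; apply: clM => B /rnorm_nbhs[e e0 eB].
by have [m Mm lm] := lM _ e0; exists m; split => //; exact: eB.
Qed.

Lemma linear_sub A : linear A -> {morph A : x y / x - y}.
Proof. by move=> lA x y; rewrite addrC -scaleN1r lA scaleN1r addrC. Qed.
Lemma linear_0 A : linear A -> A 0 = 0.
Proof. by move=> lA; rewrite -[X in A X](subrr 0) linear_sub// subrr. Qed.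
Lemma linear_scale A : linear A -> forall a, {morph A : x / a *: x}.
Proof.
move=> lA a x; by rewrite -[a *: x]addr0 lA linear_0// addr0.
Qed.
Lemma linear_add A : linear A -> {morph A : x y / x + y}.
Proof. by move=> lA x y; have := lA 1 x y; rewrite !scale1r. Qed.

Lemma boundedP A : bounded_operator A <->
  linear A /\ exists2 C : R, 0 < C & forall x, rnorm (A x) <= C * rnorm x.
Proof.
split=> -[lA]; last first.
  move=> [C C0 AC]; split=> // x B /rnorm_nbhs[e e0 eB]; apply/rnorm_nbhs.
  exists (e / C); first by rewrite divr_gt0.
  move=> y; rewrite ltr_pdivlMr// => xy; apply: eB.
  by rewrite -linear_sub//; apply: le_lt_trans (AC _) _; rewrite mulrC.
move=> cA; split=> //.
have : nbhs (A 0) [set y | rnorm y < 1].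
  by apply/rnorm_nbhs; exists 1 => // y; rewrite linear_0// sub0r rnormN.
move/(cA 0)/rnorm_nbhs => [e e0 eA].
exists (2 / e); first by rewrite divr_gt0.
move=> x; have [x0|x0] := eqVneq (rnorm x) 0.
  by rewrite (rnorm_eq0 x0) linear_0// rnorm0 mulr0.
have x_gt0 : 0 < rnorm x by rewrite lt_def x0 rnorm_ge0.
(* This factor rescales [x] to norm [e / 2], inside the ball on which the values of [A] have norm
   below 1; [t^-1] is the required bound. *)
pose t := e / (2 * rnorm x).
have t0 : 0 < t by rewrite divr_gt0// mulr_gt0.
have /= := eA (t%:C *: x); rewrite sub0r rnormN rnormZr linear_scale// rnormZr.
rewrite gtr0_norm// => /(_ _)/ltW h.
have -> : 2 / e * rnorm x = t^-1 by rewrite /t invf_div mulrAC.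
have te : t * rnorm x < e.
  have -> : t * rnorm x = e / 2 by rewrite /t; field.
  by rewrite gtr_pMr// invf_lt1// ltr1n.
by rewrite -(ler_pM2l t0) mulfV ?gt_eqF//; exact: h.
Qed.

Lemma bounded_comp A B : bounded_operator A -> bounded_operator B ->
  bounded_operator (A \o B).
Proof.
move=> [lA cA] [lB cB]; split; first by move=> a x y /=; rewrite lB lA.
by move=> x; apply: continuous_comp; [exact: cB|exact: cA].
Qed.

Lemma bounded_sub A B : bounded_operator A -> bounded_operator B ->
  bounded_operator (A \- B).
Proof.
move=> [lA cA] [lB cB]; split; last by move=> x; apply: cvgB; [exact: cA|exact: cB].
by move=> a x y /=; rewrite lB lA scalerBr opprD addrACA.
Qed.

Lemma bounded_add A B : bounded_operator A -> bounded_operator B ->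
  bounded_operator (A \+ B).
Proof.
move=> [lA cA] [lB cB]; split; last by move=> x; apply: cvgD; [exact: cA|exact: cB].
by move=> a x y /=; rewrite lB lA scalerDr addrACA.
Qed.

Lemma bounded_id : bounded_operator (@idfun H).
Proof. by split=> // x; exact: cvg_id. Qed.

End real_norm.

(** * Projection, Riesz and Lax-Milgram theorems *)

Section hilbert_space.
Set Implicit Arguments.
Unset Strict Implicit.
Context {R : realType} {H : completeNormedModType R[i]}.
Variable ip : {dot H for Num.conj}.
Hypothesis ip_norm : hilbert_norm ip.
Implicit Types (x y z w : H) (A B D P S X : H -> H) (M : set H).

Lemma ipC x y : ip y x = (ip x y)^*%C.
Proof. by rewrite hermC /= expr0 mul1r. Qed.
Lemma ipDl x y z : ip (x + y) z = ip x z + ip y z. Proof. exact: linearDl. Qed.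
Lemma ipBl x y z : ip (x - y) z = ip x z - ip y z. Proof. exact: linearBl. Qed.
Lemma ipZl a x y : ip (a *: x) y = a * ip x y. Proof. exact: linearZl_LR. Qed.
Lemma ipDr x y z : ip z (x + y) = ip z x + ip z y. Proof. exact: linearDr. Qed.
Lemma ipBr x y z : ip z (x - y) = ip z x - ip z y. Proof. exact: linearBr. Qed.
Lemma ipZr a x y : ip x (a *: y) = a^*%C * ip x y. Proof. exact: linearZr_LR. Qed.
Lemma ip0l x : ip 0 x = 0. Proof. exact: linear0l. Qed.

(** A real inner product inducing the same norm, which keeps the estimates in [R]. *)
Definition rdot x y : R := complex.Re (ip x y).

Lemma rdotC x y : rdot x y = rdot y x.
Proof. by rewrite /rdot (ipC y x); case: (ip y x). Qed.
Lemma rdotDl x y z : rdot (x + y) z = rdot x z + rdot y z.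
Proof. by rewrite /rdot ipDl; case: (ip x z); case: (ip y z). Qed.
Lemma rdotZl (t : R) x y : rdot (t%:C *: x) y = t * rdot x y.
Proof. by rewrite /rdot ipZl; case: (ip x y) => a b /=; rewrite mul0r subr0. Qed.
Lemma rdotNl x y : rdot (- x) y = - rdot x y.
Proof. by rewrite -scaleN1r -[-1](rmorphN1 (real_complex R)) rdotZl mulN1r. Qed.
Lemma rdotBl x y z : rdot (x - y) z = rdot x z - rdot y z.
Proof. by rewrite rdotDl rdotNl. Qed.
Lemma rdotDr x y z : rdot z (x + y) = rdot z x + rdot z y.
Proof. by rewrite !(rdotC z) rdotDl. Qed.
Lemma rdotZr (t : R) x y : rdot y (t%:C *: x) = t * rdot y x.
Proof. by rewrite !(rdotC y) rdotZl. Qed.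
Lemma rdotNr x y : rdot y (- x) = - rdot y x.
Proof. by rewrite !(rdotC y) rdotNl. Qed.

Lemma rdotxx x : rdot x x = rnorm x ^+ 2.
Proof. by rewrite /rdot ip_norm normE -rmorphXn. Qed.

(** As the form is conjugate linear on the right, the second real part is the imaginary part of
    [ip x y]. *)
Lemma ip_eq0 x y : rdot x y = 0 -> rdot x ('i *: y) = 0 -> ip x y = 0.
Proof.
rewrite /rdot ipZr; case: (ip x y) => a b /= ->.
by rewrite mul0r mulN1r opprK add0r => ->.
Qed.

Lemma ip_inj y z : (forall x, ip x y = ip x z) -> y = z.
Proof.
move=> yz; apply/eqP; rewrite -subr_eq0; apply/eqP/rnorm_eq0/eqP.
by rewrite -(sqrf_eq0 (rnorm _)) -rdotxx /rdot ipBr yz subrr.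
Qed.

Lemma rnormD2 x y : rnorm (x + y) ^+ 2 = rnorm x ^+ 2 + 2 * rdot x y + rnorm y ^+ 2.
Proof. rewrite -!rdotxx !rdotDl !rdotDr (rdotC y x); ring. Qed.

(** Cauchy-Schwarz: expand the squared norm of [|y| x - |x| y], which is nonnegative, and divide by
    [|x| |y|]. *)
Lemma rdot_le x y : rdot x y <= rnorm x * rnorm y.
Proof.
have [x0|x0] := eqVneq (rnorm x) 0.
  by rewrite (rnorm_eq0 x0) /rdot ip0l rnorm0 mul0r.
have [y0|y0] := eqVneq (rnorm y) 0.
  by rewrite rdotC (rnorm_eq0 y0) /rdot ip0l rnorm0 mulr0.
have p : 0 < rnorm x * rnorm y by rewrite mulr_gt0// lt_def ?x0 ?y0 rnorm_ge0.
have := sqr_ge0 (rnorm ((rnorm y)%:C *: x - (rnorm x)%:C *: y)).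
rewrite rnormD2 rdotNr rdotZl rdotZr rnormN !rnormZr !ger0_norm ?rnorm_ge0// => h.
rewrite -(ler_pM2l p); lra.
Qed.

Lemma rdot_norm_le x y : `|rdot x y| <= rnorm x * rnorm y.
Proof. by rewrite ler_norml rdot_le andbT lerNl -rdotNl -(rnormN x) rdot_le. Qed.

Definition subspace M : Prop := M 0 /\ forall a x y, M x -> M y -> M (a *: x + y).

Lemma range_subspace A : linear A -> subspace (range A).
Proof.
move=> lA; split; first by exists 0 => //; exact: linear_0.
by move=> a _ _ [x _ <-] [y _ <-]; exists (a *: x + y) => //; exact: lA.
Qed.

(** The first-order condition at a minimum. At [t = g / (b + 1)] the quadratic is a negative
    multiple of [g ^+ 2]; the added 1 covers [b = 0]. *)
Lemma quadratic_ge0_lin0 (g b : R) : 0 <= b ->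
  (forall t, 0 <= - 2 * t * g + t ^+ 2 * b) -> g = 0.
Proof.
move=> b0 /(_ (g / (b + 1))).
have b1 : 0 < b + 1 by rewrite ltr_wpDl.
have -> : - 2 * (g / (b + 1)) * g + (g / (b + 1)) ^+ 2 * b =
  - (g ^+ 2 * ((b + 2) / (b + 1) ^+ 2)) by field; rewrite gt_eqF.
rewrite oppr_ge0 pmulr_lle0; last by rewrite divr_gt0 ?exprn_gt0// ltr_wpDl.
by move=> g2; apply/eqP; rewrite -(sqrf_eq0 g) eq_le g2 sqr_ge0.
Qed.

(** The nearest point of [M] to [x] is the limit of a minimizing sequence, which converges by the
    parallelogram identity; minimality gives orthogonality. *)
Lemma projection_exists M : subspace M -> approx_closed M ->
  forall x, exists2 m, M m & forall y, M y -> ip (x - m) y = 0.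
Proof.
move=> [M0 lM] clM x.
pose E := [set rnorm (x - m) | m in M]; set s := inf E.
have Elb : lbound E 0 by move=> _ [m _ <-]; exact: rnorm_ge0.
have infE : has_inf E by split; [exists (rnorm (x - 0)), 0|exists 0].
have s_le m : M m -> s <= rnorm (x - m).
  by move=> Mm; apply: ge_inf; [exists 0|exists m].
have s0 : 0 <= s by apply: lb_le_inf => //; case: infE.
pose r : R := 2^-1.
have r0 : 0 < r by rewrite invr_gt0.
have r1 : r < 1 by rewrite invf_lt1// ltr1n.
have r01 : 0 <= r < 1 by rewrite (ltW r0).
(* The excess over the infimum is a square because the parallelogram identity controls squared
   distances: increments are then of order [r ^+ n]. *)
have /choice[u uP] n : exists m, M m /\ rnorm (x - m) <= s + (r ^+ n) ^+ 2.
  have [|_ [m Mm <-] /ltW h] := @inf_adherent _ E ((r ^+ n) ^+ 2) _ infE.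
    by rewrite !exprn_gt0.
  by exists m.
have uM n := (uP n).1; have us n := (uP n).2.
have [|m0 m0P] := @geometric_limit R H u (2 * (s + 1)) r r01.
  move=> n; have rn0 : 0 <= r ^+ n by rewrite exprn_ge0 ?ltW.
  have rn1 : r ^+ n <= 1 by rewrite exprn_ile1 ?ltW.
  rewrite -(@ler_pXn2r _ 2) ?nnegrE ?rnorm_ge0//; last first.
    by rewrite !mulr_ge0// addr_ge0.
  have -> : u n.+1 - u n = (x - u n) + - (x - u n.+1).
    by rewrite opprB [RHS]addrC addrA subrK.
  (* The midpoint lies in [M], so its distance to [x] is at least [s]; this bounds the other
     diagonal of the parallelogram from above. *)
  have Mmid : M ((r%:C : R[i]) *: (u n + u n.+1)).
    have h : M (u n + u n.+1) by have := lM 1 _ _ (uM n) (uM n.+1); rewrite scale1r.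
    by have := lM r%:C _ _ h M0; rewrite addr0.
  have midE : (x - u n) + (x - u n.+1) =
              (2 : R)%:C *: (x - r%:C *: (u n + u n.+1)).
    rewrite scalerBr scalerA -rmorphM /= mulfV// scale1r.
    by rewrite rmorphMn rmorph1 -mulr_natl mulr1 scaler_nat mulr2n opprD addrACA.
  have mid : s ^+ 2 <= rnorm (x - r%:C *: (u n + u n.+1)) ^+ 2.
    by rewrite ler_pXn2r ?nnegrE ?rnorm_ge0 ?s_le.
  have := congr1 (fun v => rnorm v ^+ 2) midE; rewrite /= rnormZr exprMn ger0_norm//.
  rewrite (rnormD2 (x - u n) (x - u n.+1)) (rnormD2 _ (- (x - u n.+1))) rnormN rdotNr.
  have h1 : rnorm (x - u n) ^+ 2 <= (s + (r ^+ n) ^+ 2) ^+ 2.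
    by rewrite ler_pXn2r ?nnegrE ?rnorm_ge0 ?addr_ge0 ?sqr_ge0.
  have h2 : rnorm (x - u n.+1) ^+ 2 <= (s + (r ^+ n) ^+ 2) ^+ 2.
    rewrite ler_pXn2r ?nnegrE ?rnorm_ge0 ?addr_ge0 ?sqr_ge0//.
    apply: le_trans (us _) _; rewrite lerD2l ler_pXn2r ?nnegrE ?exprn_ge0 ?ltW//.
    by rewrite exprS gtr_pMl// exprn_gt0.
  move: (rnorm (x - u n) ^+ 2) (rnorm (x - u n.+1) ^+ 2) (rdot _ _)
    (rnorm (x - r%:C *: _) ^+ 2) h1 h2 mid.
  move: (r ^+ n) rn0 rn1 => p p0 p1 a b c d h1 h2 mid eq.
  have p2 : p ^+ 2 <= 1 by rewrite exprn_ile1.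
  have p4 : p ^+ 2 * p ^+ 2 <= p ^+ 2 by rewrite ler_piMl ?sqr_ge0.
  have sp : 0 <= s ^+ 2 * p ^+ 2 by rewrite mulr_ge0 ?sqr_ge0.
  have e1 : (s + p ^+ 2) ^+ 2 = s ^+ 2 + 2 * (s * p ^+ 2) + p ^+ 2 * p ^+ 2 by ring.
  have -> : (2 * (s + 1) * p) ^+ 2 =
    4 * (s ^+ 2 * p ^+ 2) + 8 * (s * p ^+ 2) + 4 * p ^+ 2 by ring.
  rewrite e1 in h1 h2; lra.
set K := _ / _ in m0P.
have Mm0 : M m0.
  apply: clM => e e0; have [n nP] := @geometric_small R K r e r01 e0.
  by exists (u n) => //; exact: le_lt_trans (m0P n) nP.
have xm0 : rnorm (x - m0) <= s.
  apply: (@geometric_le R (1 + K) r _ _ r01) => n.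
  apply: le_trans (ler_rdistD (u n) _ _) _; rewrite mulrDl addrA mul1r.
  apply: lerD; last by rewrite rdistC; exact: m0P.
  apply: le_trans (us n) _; rewrite lerD2l.
  by rewrite expr2 ler_piMl ?exprn_ge0 ?exprn_ile1 ?ltW.
exists m0 => // y.
(* Moving [m0] along [z] by any real [t] cannot decrease the distance to [x], so the linear term in
   [t] vanishes. *)
have key z : M z -> rdot (x - m0) z = 0.
  move=> Mz; apply: (@quadratic_ge0_lin0 _ (rnorm z ^+ 2)); first exact: sqr_ge0.
  move=> t; have Mt : M (t%:C *: z + m0) by exact: lM.
  have := s_le _ Mt.
  have -> : x - (t%:C *: z + m0) = x - m0 - t%:C *: z by rewrite opprD addrA addrAC.
  move=> st.
  have : rnorm (x - m0) ^+ 2 <= rnorm (x - m0 - t%:C *: z) ^+ 2.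
    by rewrite ler_pXn2r ?nnegrE ?rnorm_ge0// (le_trans xm0 st).
  rewrite (rnormD2 (x - m0)) rnormN rnormZr rdotNr rdotZr exprMn real_normK ?num_real//; lra.
move=> My; apply: ip_eq0; first exact: key.
by apply: key; have := lM 'i y 0 My M0; rewrite addr0.
Qed.

(** Riesz representation of the functional sending [x] to [ip (A x) y]: [z] is a multiple of a
    vector orthogonal to its kernel [M]. *)
Lemma adjoint_point A y : bounded_operator A ->
  exists z, forall x, ip (A x) y = ip x z.
Proof.
move=> /boundedP[lA [C C0 AC]].
pose M := [set x | ip (A x) y = 0].
have sM : subspace M.
  split; first by rewrite /M /= linear_0// ip0l.
  by move=> a u v; rewrite /M /= => hu hv; rewrite lA ipDl ipZl hu hv mulr0 addr0.
have clM : approx_closed M.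
  move=> l lM.
  (* The real and imaginary parts of the equation defining [M] are the cases [v = y] and
     [v = 'i *: y]; each passes to the limit [l]. *)
  have key v : (forall m, M m -> rdot (A m) v = 0) -> rdot (A l) v = 0.
    move=> Mv; apply/eqP; rewrite -normr_le0; apply/ler_addgt0Pr => e e0.
    have d0 : 0 < C * (rnorm v + 1) by rewrite mulr_gt0// ltr_wpDl ?rnorm_ge0.
    have [|m Mm lm] := lM (e / (C * (rnorm v + 1))); first exact: divr_gt0.
    have -> : rdot (A l) v = rdot (A (l - m)) v.
      by rewrite linear_sub// rdotBl (Mv m)// subr0.
    rewrite add0r; apply: le_trans (rdot_norm_le _ _) _.
    apply: le_trans (ler_wpM2r (rnorm_ge0 _) (AC _)) _.
    move: lm; rewrite ltr_pdivlMr// => /ltW; apply: le_trans.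
    rewrite -mulrA mulrCA ler_wpM2l ?rnorm_ge0// ler_wpM2l ?lerDl//.
    exact: ltW.
  apply: ip_eq0; apply: key => m Mm; rewrite /rdot ?ipZr.
    by rewrite Mm.
  by rewrite (Mm : _ = 0) mulr0.
have [zero|] := pselect (forall x, ip (A x) y = 0).
  by exists 0 => x; rewrite zero ipC ip0l conjc0.
move=> /existsNP[x0 /eqP x0y].
have [m Mm mP] := projection_exists sM clM x0.
set u := x0 - m in mP.
have fu : ip (A u) y != 0 by rewrite linear_sub// ipBl (Mm : _ = 0) subr0.
have uu : ip u u != 0.
  apply: contra fu; rewrite ip_norm sqrf_eq0 normr_eq0 => /eqP ->.
  by rewrite linear_0// ip0l.
(* Subtracting from [x] the multiple of [u] with the same functional value leaves an element of [M],
   orthogonal to [u]; this determines the coefficient. *)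
exists ((ip (A u) y / ip u u)^*%C *: u) => x.
have /mP : M (x - (ip (A x) y / ip (A u) y) *: u).
  by rewrite /M /= linear_sub// linear_scale// ipBl ipZl divfK// subrr.
rewrite ipC ipBl ipZl => /(congr1 conjc); rewrite conjcK conjc0 => /eqP.
rewrite subr_eq0 ipZr conjcK => /eqP ->.
by rewrite [RHS]mulrC -mulrA [X in _ / _ * X]mulrC !divfK.
Qed.

(** The pointwise representatives depend linearly on [y] by uniqueness, and [|B y|^2 = <A (B y), y>]
    gives [B] the bound [C] of [A]. *)
Lemma adjoint_exists A : bounded_operator A -> exists B, is_adjoint ip A B.
Proof.
move=> bA; have /choice[B BP] y := adjoint_point y bA.
exists B; split=> //; have [lA [C C0 AC]] := (boundedP A).1 bA.
apply/boundedP; split.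
  by move=> a y z; apply: ip_inj => x; rewrite -BP !ipDr !ipZr -!BP.
exists C => // y; have [By0|By0] := eqVneq (rnorm (B y)) 0.
  by rewrite By0 mulr_ge0 ?rnorm_ge0 ?ltW.
have By_gt0 : 0 < rnorm (B y) by rewrite lt_def By0 rnorm_ge0.
rewrite -(ler_pM2l By_gt0) -expr2 -rdotxx /rdot -BP.
apply: le_trans (rdot_le _ _) _; rewrite mulrCA mulrA.
by rewrite ler_wpM2r ?rnorm_ge0.
Qed.

(** Coercivity makes [B] bounded below, hence injective with bounded inverse. A solution of
    [B x = y] is a fixed point of [x - t (B x - y)], a contraction for small [t]. *)
Lemma lax_milgram B (c : R) : bounded_operator B -> 0 < c ->
  (forall x, c * rnorm x ^+ 2 <= rdot (B x) x) ->
  exists D, [/\ bounded_operator D, forall x, B (D x) = x & forall x, D (B x) = x].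
Proof.
move=> /boundedP[lB [C C0 BC]] c0 coer.
have lower x : c * rnorm x <= rnorm (B x).
  have [x0|x0] := eqVneq (rnorm x) 0; first by rewrite x0 mulr0 rnorm_ge0.
  have x_gt0 : 0 < rnorm x by rewrite lt_def x0 rnorm_ge0.
  rewrite -(ler_pM2r x_gt0) -mulrA -expr2; apply: le_trans (coer x) _.
  exact: rdot_le.
have inj x y : B x = B y -> x = y.
  move=> xy; apply/eqP; rewrite -subr_eq0; apply/eqP/rnorm_eq0/le_anti.
  rewrite rnorm_ge0 andbT -(ler_pM2l c0) mulr0.
  by apply: le_trans (lower _) _; rewrite linear_sub// xy subrr rnorm0.
(* Both [C] and [c] are at most [b], so [k >= 0]. The choice of [t] minimizes [1 - 2 t c + t^2 b^2],
   with minimum [k]. *)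
pose b := C + c; have b0 : 0 < b by rewrite addr_gt0.
pose t := c / b ^+ 2; pose k := 1 - c ^+ 2 / b ^+ 2.
have t0 : 0 < t by rewrite divr_gt0// exprn_gt0.
have k1 : k < 1 by rewrite gtrBl divr_gt0// exprn_gt0.
have k0 : 0 <= k.
  rewrite subr_ge0 ler_pdivrMr ?exprn_gt0// mul1r ler_pXn2r ?nnegrE ?ltW//.
  by rewrite ltrDr.
have step v : rnorm (v - t%:C *: B v) <= Num.sqrt k * rnorm v.
  rewrite -(@ler_pXn2r _ 2) ?nnegrE ?mulr_ge0 ?rnorm_ge0 ?sqrtr_ge0//.
  rewrite exprMn sqr_sqrtr// rnormD2 rdotNr rdotZr rnormN rnormZr gtr0_norm//.
  have Bb : (t * rnorm (B v)) ^+ 2 <= (t * (b * rnorm v)) ^+ 2.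
    have tBb : t * rnorm (B v) <= t * (b * rnorm v).
      rewrite ler_pM2l//; apply: le_trans (BC _) _.
      by rewrite ler_wpM2r ?rnorm_ge0// lerDl ltW.
    have tB0 : 0 <= t * rnorm (B v) by rewrite mulr_ge0 ?rnorm_ge0 ?(ltW t0).
    by rewrite ler_pXn2r ?nnegrE// (le_trans tB0 tBb).
  have tc : t * (c * rnorm v ^+ 2) <= t * rdot v (B v).
    by rewrite ler_pM2l// rdotC.
  have e1 : (t * (b * rnorm v)) ^+ 2 = c ^+ 2 / b ^+ 2 * rnorm v ^+ 2.
    by rewrite /t; field; rewrite gt_eqF.
  have e2 : t * (c * rnorm v ^+ 2) = c ^+ 2 / b ^+ 2 * rnorm v ^+ 2.
    by rewrite /t; field; rewrite gt_eqF.
  rewrite e1 in Bb; rewrite e2 in tc; rewrite /k; lra.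
have surj y : exists x, B x = y.
  have [||x xP] := @contraction_fixpoint R H (fun x => x - t%:C *: (B x - y)) (Num.sqrt k).
  - by rewrite sqrtr_ge0 -sqrtr1 ltr_sqrt.
  - move=> u v; apply: le_trans (step (u - v)).
    by rewrite opprD addrACA -opprD -scalerBr opprB addrA subrK -linear_sub.
  exists x; move/eqP: xP; rewrite -subr_eq0 addrAC subrr add0r oppr_eq0 scaler_eq0.
  have /negbTE -> : (t%:C : R[i]) != 0.
    by rewrite -(rmorph0 (real_complex R)) (inj_eq (@complexI R)) gt_eqF.
  by rewrite subr_eq0 => /eqP.
have /choice[D DP] := surj.
exists D; split=> //; last by move=> x; apply: inj; rewrite DP.
apply/boundedP; split; first by move=> a x y; apply: inj; rewrite lB !DP.
exists c^-1; first by rewrite invr_gt0.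
by move=> x; rewrite ler_pdivlMl//; apply: le_trans (lower _) _; rewrite DP.
Qed.

(* A gliding hump: if S* were not bounded below on M = range S, the partial sums
   of [sum +- 3^-n w_n] would converge in M to some S x whose inner products
   with w_n are at least 3^-n / 2 and at most |x| 9^-n in absolute value. *)
Lemma closed_range_adjoint_lower S Sa : closed (range S) -> bounded_operator S ->
  is_adjoint ip S Sa ->
  exists2 c : R, 0 < c & forall w, range S w -> c * rnorm w <= rnorm (Sa w).
Proof.
move=> /closed_approx clS [lS _] [bSa adj].
have [S0 sS] := range_subspace lS; have [lSa _] := bSa.
have [//|none] := pselect (exists2 c : R, 0 < c &
  forall w, range S w -> c * rnorm w <= rnorm (Sa w)).
(* With ratio 1/3 the terms after the [n]-th sum to at most [q ^+ n / 2], so they cannot cancel more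
   than half of the [n]-th term. *)
pose q : R := 3^-1.
have q0 : 0 < q by rewrite invr_gt0.
have q1 : q < 1 by rewrite invf_lt1// ltr1n.
have q01 : 0 <= q < 1 by rewrite ltW.
have /choice[w wP] n : exists w, [/\ range S w, rnorm w = 1 & rnorm (Sa w) <= (q ^+ n) ^+ 2].
  have [w [Sw /negP]] : exists w, range S w /\ ~ ((q ^+ n) ^+ 2 * rnorm w <= rnorm (Sa w)).
    apply: contrapT => h; apply: none; exists ((q ^+ n) ^+ 2); first by rewrite !exprn_gt0.
    by move=> w Sw; apply: contrapT => hw; apply: h; exists w.
  rewrite -ltNge => hw; have w0 : 0 < rnorm w.
    rewrite lt_def rnorm_ge0 andbT; apply: contraTN hw => /eqP ->.
    by rewrite mulr0 -leNgt rnorm_ge0.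
  exists ((rnorm w)^-1%:C *: w); split.
  - by have := sS (rnorm w)^-1%:C _ _ Sw S0; rewrite addr0.
  - by rewrite rnormZr gtr0_norm ?invr_gt0// mulVf// gt_eqF.
  - rewrite linear_scale// rnormZr gtr0_norm ?invr_gt0// ler_pdivrMl// mulrC.
    exact: ltW.
have wS n : range S (w n) by case: (wP n).
have w1 n : rnorm (w n) = 1 by case: (wP n).
have Saw n : rnorm (Sa (w n)) <= (q ^+ n) ^+ 2 by case: (wP n).
(* The sign makes the new term reinforce the inner product that the partial sum already has with
   [w n]. *)
pose sgn z n : R := if 0 <= rdot z (w n) then 1 else -1.
pose z := fix z n := if n is m.+1 then (sgn (z m) m * q ^+ m)%:C *: w m + z m else 0.
have zS n : range S (z n) by elim: n => //= n IH; exact: sS.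
have zD n : rnorm (z n.+1 - z n) = q ^+ n.
  rewrite /= addrK rnormZr w1 mulr1 normrM (ger0_norm (exprn_ge0 _ (ltW q0))).
  by rewrite /sgn; case: ifP => _; rewrite ?normrN normr1 mul1r.
have zw n : q ^+ n <= `|rdot (z n.+1) (w n)|.
  have qn : 0 <= q ^+ n by rewrite exprn_ge0 ?ltW.
  rewrite /= rdotDl rdotZl rdotxx w1 expr1n mulr1 /sgn; case: ifPn => h.
    by rewrite mul1r ger0_norm ?addr_ge0// lerDl.
  by rewrite -ltNge in h; rewrite mulN1r ltr0_norm; lra.
have [|l lP] := @geometric_limit R H z 1 q q01.
  by move=> n; rewrite zD mul1r.
have [x _ xl] : range S l.
  apply: clS => e e0; have [n nP] := @geometric_small R (1 / (1 - q)) q e q01 e0.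
  by exists (z n) => //; exact: le_lt_trans (lP n) nP.
have bnd n : q ^+ n * 2^-1 <= rnorm x * (q ^+ n) ^+ 2.
  have a1 : `|rdot l (w n)| <= rnorm x * (q ^+ n) ^+ 2.
    rewrite -xl /rdot adj; apply: le_trans (rdot_norm_le _ _) _.
    by rewrite ler_wpM2l ?rnorm_ge0.
  have a2 : `|rdot (l - z n.+1) (w n)| <= q ^+ n * 2^-1.
    apply: le_trans (rdot_norm_le _ _) _; rewrite w1 mulr1.
    apply: le_trans (lP _) _; rewrite exprS mulrCA mulrA mulrC.
    by rewrite (_ : q * _ = 2^-1)// /q; field.
  have := zw n; have := ler_normB (rdot l (w n)) (rdot (l - z n.+1) (w n)).
  rewrite -rdotBl opprB addrC subrK; lra.
have [|n] := @geometric_small R (rnorm x) q 2^-1 q01; first by rewrite invr_gt0.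
rewrite ltNge => /negP; case; have := bnd n.
by rewrite expr2 mulrCA ler_pM2l// exprn_gt0.
Qed.

(** * Generalized inverses of closed range operators *)

Lemma adjoint_sym A B : is_adjoint ip A B -> forall x y, ip (B x) y = ip x (A y).
Proof. by move=> [_ adj] x y; rewrite ipC -adj -ipC. Qed.

Lemma rdot_conjZl (a : R[i]) x y : rdot (a^*%C *: x) y = rdot x (a *: y).
Proof. by rewrite /rdot ipZl ipZr. Qed.

Lemma bounded_scale (a : R[i]) : bounded_operator (fun x : H => a *: x).
Proof.
apply/boundedP; split.
  by move=> b x y; rewrite scalerDr !scalerA mulrC.
have a0 : 0 <= complex.Re `|a| by rewrite -ler0c RRe_real.
exists (complex.Re `|a| + 1); first by rewrite ltr_wpDl.
by move=> x; rewrite rnormZ ler_wpM2r ?rnorm_ge0// lerDl.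
Qed.

(** The nearest points are chosen one by one; uniqueness of the orthogonal decomposition makes the
    choice linear and the identity on [M]. *)
Lemma orthogonal_projection_exists M : subspace M -> approx_closed M ->
  exists P, [/\ orthogonal_projection ip P, range P = M &
    forall x y, M y -> ip (x - P x) y = 0].
Proof.
move=> sM clM; have [M0 lM] := sM.
have /choice[P PP] x : exists m, M m /\ forall y, M y -> ip (x - m) y = 0.
  by have [m Mm mP] := projection_exists sM clM x; exists m.
have MP x : M (P x) by case: (PP x).
have orth x y : M y -> ip (x - P x) y = 0 by case: (PP x) => _; apply.
have MB x y : M x -> M y -> M (x - y).
  by move=> Mx My; rewrite addrC -scaleN1r; exact: lM.
have uniq x m : M m -> (forall y, M y -> ip (x - m) y = 0) -> P x = m.
  move=> Mm mP; apply/eqP; rewrite -subr_eq0; apply/eqP.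
  have MPm : M (P x - m) by exact: MB.
  apply/rnorm_eq0/eqP; rewrite -(sqrf_eq0 (rnorm _)) -rdotxx /rdot.
  rewrite {1}(_ : P x - m = (x - m) - (x - P x)); last first.
    by rewrite opprB [RHS]addrC addrA subrK.
  by rewrite ipBl orth// mP// subr0.
have lP : linear P.
  move=> a x y; apply: uniq; first exact: lM.
  move=> z Mz; rewrite opprD addrACA -scalerBr ipDl ipZl !orth//.
  by rewrite mulr0 addr0.
have idP x : M x -> P x = x.
  by move=> Mx; apply: uniq => // y _; rewrite subrr ip0l.
have PyP x y : ip (P x) (P y) = ip x (P y).
  by apply/esym/eqP; rewrite -subr_eq0 -ipBl orth.
have bP : bounded_operator P.
  apply/boundedP; split => //; exists 1 => // x; rewrite mul1r.
  have [->|Px0] := eqVneq (rnorm (P x)) 0; first exact: rnorm_ge0.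
  have Px_gt0 : 0 < rnorm (P x) by rewrite lt_def Px0 rnorm_ge0.
  rewrite -(ler_pM2r Px_gt0) -expr2 -rdotxx /rdot PyP.
  exact: rdot_le.
exists P; split => //.
- split; split=> //; first by apply/funext => x /=; rewrite idP.
  by move=> x y; rewrite -PyP [LHS]ipC [RHS]ipC PyP.
- apply/seteqP; split=> [_ [x _ <-]//|x Mx].
  by exists x => //; exact: idP.
Qed.

Lemma moore_penrose_exists S : bounded_operator S -> closed (range S) ->
  exists X, is_moore_penrose ip S X.
Proof.
move=> bS clS; have [lS _] := bS.
have [Sa adj] := adjoint_exists bS; have [bSa adjE] := adj.
have [lSa _] := bSa; have adjE' := adjoint_sym adj.
have [c c0 lower] := closed_range_adjoint_lower clS bS adj.
have [P [[[bP PP] [_ Psa]] rP orth]] :=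
  orthogonal_projection_exists (range_subspace lS) (closed_approx clS).
have [lP _] := bP.
have PE x : P (P x) = P x by exact: (congr1 (@^~ x) PP).
have PS x : P (S x) = S x.
  have [y _ <-] : range P (S x) by rewrite rP; exists x.
  exact: PE.
have P0 x : P (x - P x) = 0 by rewrite linear_sub// PE subrr.
have Sa0 x : Sa (x - P x) = 0.
  apply: ip_inj => z; rewrite -adjE ipC orth; last by exists z.
  by rewrite conjc0 ipC ip0l conjc0.
(* Block diagonal for [R(S)] and its orthogonal complement: [S S^*] acts on the first and the
   identity on the second, so the coercivity constant is the minimum of [c ^+ 2] and 1. *)
pose B := (S \o Sa) \+ (idfun \- P).
have BE x : B x = S (Sa x) + (x - P x) by [].
have bB : bounded_operator B.
  exact: bounded_add (bounded_comp bS bSa) (bounded_sub bounded_id bP).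
have Bsa x y : ip (B x) y = ip x (B y).
  by rewrite !BE ipDl ipDr ipBl ipBr adjE adjE' Psa.
pose c' := Num.min (c ^+ 2) 1.
have c'0 : 0 < c' by rewrite lt_min exprn_gt0/=.
have coer x : c' * rnorm x ^+ 2 <= rdot (B x) x.
  have Px : range S (P x) by rewrite -rP; exists x.
  have xE : x = P x + (x - P x) by rewrite addrC subrK.
  have cross : rdot (P x) (x - P x) = 0.
    by rewrite rdotC /rdot orth.
  have n2 : rnorm x ^+ 2 = rnorm (P x) ^+ 2 + rnorm (x - P x) ^+ 2.
    by rewrite {1}xE rnormD2 cross mulr0 addr0.
  have e1 : rdot (x - P x) x = rnorm (x - P x) ^+ 2.
    by rewrite [X in rdot _ X]xE rdotDr rdotC cross add0r rdotxx.
  have e2 : rdot (S (Sa x)) x = rnorm (Sa (P x)) ^+ 2.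
    have -> : Sa (P x) = Sa x.
      by apply/esym/eqP; rewrite -subr_eq0 -linear_sub// Sa0.
    by rewrite -rdotxx /rdot adjE.
  rewrite BE rdotDl e1 e2 n2 mulrDr lerD//.
    apply: (@le_trans _ _ (c ^+ 2 * rnorm (P x) ^+ 2)).
      by rewrite ler_wpM2r ?sqr_ge0// ge_min lexx.
    rewrite -exprMn ler_pXn2r ?nnegrE ?rnorm_ge0 ?lower//.
    by rewrite mulr_ge0 ?rnorm_ge0 ?(ltW c0).
  by rewrite ler_piMl ?sqr_ge0// ge_min lexx orbT.
have [D [bD BD DB]] := lax_milgram bB c'0 coer.
have [lD _] := bD.
(* [B] fixes the orthogonal complement of [R(S)], hence so does its inverse. *)
have Dperp x : D (x - P x) = x - P x.
  by rewrite -{2}(DB (x - P x)) BE Sa0 linear_0// P0 subr0 add0r.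
(* The inverse of the selfadjoint [B] is selfadjoint, which makes [S^* D S] selfadjoint as well. *)
have Dsa x y : ip (D x) y = ip x (D y) by rewrite -{1}(BD y) -Bsa BD.
have SX x : S (Sa (D x)) = P x.
  by rewrite -[in RHS](BD x) BE linear_add// P0 addr0 PS.
exists (Sa \o D); split.
- exact: bounded_comp.
- by apply/funext => x /=; rewrite SX PS.
- apply/funext => x /=; rewrite SX; apply/esym/eqP.
  by rewrite -subr_eq0 -linear_sub// -linear_sub// Dperp Sa0.
- split; first exact: bounded_comp bS (bounded_comp bSa bD).
  by move=> x y /=; rewrite !SX Psa.
- split; first exact: bounded_comp (bounded_comp bSa bD) bS.
  by move=> x y /=; rewrite adjE' Dsa adjE.
Qed.

Lemma moore_penroseP S : bounded_operator S -> closed (range S) ->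
  is_moore_penrose ip S (moore_penrose ip S).
Proof.
by move=> bS clS; exact: (@xgetPex _ _ [set X | is_moore_penrose ip S X])
  (moore_penrose_exists bS clS).
Qed.

Lemma adjointP A : bounded_operator A -> is_adjoint ip A (adjoint ip A).
Proof.
by move=> bA; exact: (@xgetPex _ _ [set B | is_adjoint ip A B]) (adjoint_exists bA).
Qed.

(** Ensures that [orth_proj] is not the default 0 here. The kernel of [P] is the orthogonal
    complement of the range of [S^*], that is [N(S)]. *)
Lemma orth_proj_row_space S : bounded_operator S -> closed (range S) ->
  let P := orth_proj ip (range (adjoint ip S)) in
  orthogonal_projection ip P /\ Defs.kernel P = Defs.kernel S.
Proof.
move=> bS clS P; have adj := adjointP bS; have [_ adjE] := adj.
have [bX SXS XSX [bSX SXsa] [bXS XSsa]] := moore_penroseP bS clS.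
set X := moore_penrose ip S in bX SXS XSX bSX SXsa bXS XSsa.
have SXSE x : S (X (S x)) = S x by exact: (congr1 (@^~ x) SXS).
have [] : orthogonal_projection ip P /\ range P = range (adjoint ip S).
  apply: (@xgetPex _ _ [set P | orthogonal_projection ip P /\
                                range P = range (adjoint ip S)]).
  have [bXa adjX] := adjointP bX.
  (* The witness is [S^+ S]: it equals its adjoint [S^* X^*], and the adjoint of [S X S = S] reads
     [X S S^* = S^*], so the two ranges agree. *)
  exists (X \o S); split.
    split; split=> //; apply/funext => x /=; by rewrite SXSE.
  apply/seteqP; split=> _ [x _ <-] /=.
    exists (adjoint ip X x) => //.
    by apply: ip_inj => z; rewrite -adjE -adjX -XSsa.
  exists (adjoint ip S x) => //.
  by apply: ip_inj => z; rewrite -XSsa -!adjE /= SXSE.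
move=> orthP rP; split => //; move: orthP => [[bP PP] [_ Psa]].
apply/seteqP; split=> x /=.
  move=> Px; apply: ip_inj => z; rewrite ipC [RHS]ipC adjE.
  have [y _ <-] : range P (adjoint ip S z) by rewrite rP; exists z.
  by rewrite -Psa Px !ip0l.
move=> Sx; apply: ip_inj => z; rewrite ipC [RHS]ipC Psa.
have [y _ <-] : range (adjoint ip S) (P z) by rewrite -rP; exists z.
by rewrite -adjE Sx !ip0l.
Qed.

(* The group inverse is S (S^3)^- S for any inner inverse of S^3. *)
Lemma group_inverse_exists S : split_operator S -> exists X, is_group_inverse S X.
Proof.
move=> [bS clS sumS capS]; have [lS _] := bS.
(* The kernel component of [x] is killed by [S], so the direct sum gives [R(S) = R(S^2)]. *)
have S2 x : exists a, S x = S (S a).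
  have [_ [v [[a _ <-] Sv xE]]] := sumS x; exists a.
  by rewrite xE linear_add// (Sv : _ = 0) addr0.
have S3 x : exists z, S x = S (S (S z)).
  by have [a ->] := S2 x; have [z ->] := S2 a; exists z.
(* Trivial intersection of range and kernel means [N(S^2) = N(S)]: repeated factors [S] can be
   cancelled. *)
have cancelS w : S (S w) = 0 -> S w = 0.
  move=> SSw; suff : [set 0] (S w) by [].
  by rewrite -capS; split => //; exists w.
have rS3 : range (S \o S \o S) = range S.
  apply/seteqP; split=> _ [x _ <-] /=; first by exists (S (S x)).
  by have [z ->] := S3 x; exists z.
have bS3 := bounded_comp (bounded_comp bS bS) bS.
have [|Y [bY YE _ _ _]] := moore_penrose_exists bS3; first by rewrite rS3.
have YP z : S (S (S (Y (S (S (S z)))))) = S (S (S z)).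
  exact: (congr1 (@^~ z) YE).
pose X := S \o Y \o S.
(* Here [X x = S Y S^3 z]. Since [S^3 Y S^3 z = S^3 z], cancelling two factors [S] leaves [S z]. *)
have XP x z : S x = S (S (S z)) -> X x = S z.
  move=> Sx; rewrite /X /= Sx; apply/eqP; rewrite -subr_eq0 -linear_sub//.
  by apply/eqP; apply: (cancelS); apply: (cancelS); rewrite !linear_sub// YP subrr.
have XS x z : S x = S (S z) -> X (S x) = S z by move=> Sx; apply: XP; rewrite Sx.
have SX x z : S x = S (S z) -> S (X x) = S z.
  by move=> Sx; have [y zE] := S2 z; rewrite (XP x y) // Sx zE.
have XSX x : X (S x) = S (X x).
  by have [z Sx] := S2 x; rewrite (XS _ _ Sx) (SX _ _ Sx).
have SXS x : S (X (S x)) = S x.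
  by have [z Sx] := S2 x; rewrite (XS _ _ Sx) Sx.
exists X; split.
- exact: bounded_comp (bounded_comp bS bY) bS.
- by apply/funext => x /=; rewrite SXS.
- apply/funext => x; have [z Sx] := S3 x.
  by rewrite /comp (XP _ _ Sx) XSX; rewrite -XSX [in RHS]/= -[RHS]SXS XSX.
- by apply/funext => x /=; rewrite XSX.
Qed.

Lemma group_inverseP S : split_operator S -> is_group_inverse S (group_inverse S).
Proof.
by move=> spS; exact: (@xgetPex _ _ [set X | is_group_inverse S X])
  (group_inverse_exists spS).
Qed.

(** * Spectral radius and operator norm estimates *)

(** For [|l| > k], multiplying [A - l] by minus the conjugate of [l] gives an operator with
    coercivity constant [|l| (|l| - k)], invertible by Lax-Milgram. *)
Lemma spectral_radius_le A (k : R) : bounded_operator A ->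
  (forall x, rnorm (A x) <= k * rnorm x) -> (spectral_radius A <= k%:E)%E.
Proof.
move=> bA Ak; have [lA _] := bA.
apply: ge_ereal_sup => _ [l lspec <-]; rewrite lee_fin leNgt; apply/negP => kl.
apply: lspec; set m := complex.Re `|l| in kl.
have m0 : 0 <= m by rewrite /m -ler0c RRe_real.
(* A negative [k] forces [H = 0], where the identity inverts every [A - l]. *)
have [k0|k0] := ltP k 0.
  have H0 x : x = 0 :> H.
    apply: rnorm_eq0; apply/eqP; rewrite eq_le rnorm_ge0 andbT leNgt; apply/negP => x0.
    have := le_trans (rnorm_ge0 _) (Ak x); rewrite leNgt pmulr_llt0//.
    by rewrite k0.
  by exists idfun; split=> [|x|x]; [exact: bounded_id|rewrite (H0 (idfun _)) (H0 x)..].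
have {}m0 : 0 < m by exact: le_lt_trans k0 kl.
pose a := - l^*%C; pose Al := A \- (fun x => l *: x).
have bAl : bounded_operator Al by exact: bounded_sub bA (bounded_scale l).
have a0 : a != 0.
  rewrite oppr_eq0 conjc_eq0; apply: contraTneq m0 => l0.
  by rewrite /m l0 normr0 ltxx.
have [||D [bD BD DB]] := lax_milgram (bounded_comp (bounded_scale a) bAl)
    (c := m * (m - k)).
- by rewrite mulr_gt0 ?subr_gt0.
- move=> x; rewrite /= /Al /= /a scaleNr rdotNl rdot_conjZl rdotBl opprB rdotxx.
  have := rdot_le (A x) (l *: x); rewrite rnormZ -/m.
  have := ler_wpM2r (mulr_ge0 (ltW m0) (rnorm_ge0 x)) (Ak x).
  lra.
exists (D \o (fun x => a *: x)); split.
- exact: bounded_comp bD (bounded_scale a).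
- by move=> x; have := DB x.
- by move=> x; have := BD (a *: x); move/(scalerI a0).
Qed.

(** Homogeneity extends the bound from the unit ball to all vectors. The value at 0 makes the
    supremum nonnegative, hence finite, so [fine] loses nothing. *)
Lemma operator_norm_lt1 A : linear A -> (operator_norm A < 1)%E ->
  exists2 k : R, k < 1 & forall x, rnorm (A x) <= k * rnorm x.
Proof.
move=> lA A1.
have ub x : rnorm x <= 1 -> ((rnorm (A x))%:E <= operator_norm A)%E.
  by move=> x1; apply: ereal_sup_ubound; exists x => //=; rewrite normE lecR.
have A0 : (0 <= operator_norm A)%E.
  by have := ub 0; rewrite linear_0// rnorm0; apply.
have Afin : operator_norm A \is a fin_num.
  by rewrite ge0_fin_numE// (lt_trans A1)// ltry.
exists (fine (operator_norm A)); first by rewrite -lte_fin fineK.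
move=> x; have [x0|x0] := eqVneq (rnorm x) 0.
  by rewrite (rnorm_eq0 x0) linear_0// rnorm0 mulr0.
have x_gt0 : 0 < rnorm x by rewrite lt_def x0 rnorm_ge0.
have := ub ((rnorm x)^-1%:C *: x).
rewrite linear_scale// !rnormZr gtr0_norm ?invr_gt0// mulVf// lexx => /(_ isT).
by rewrite -(fineK Afin) lee_fin mulrC ler_pdivrMr//.
Qed.

(** * Convergence of the group proper splitting under the two orders *)

(** The criterion shared by both orders; it involves only [S] and [P], no longer [T]. *)
Lemma group_splitting_converges S (k : R) : split_operator S ->
  let P := orth_proj ip (range (adjoint ip S)) in
  k < 1 -> (forall x, rnorm (P x - P (S (S x))) <= k * rnorm x) ->
  group_proper_splitting_converges ip S.
Proof.
move=> spS P k1 Pk; have [bS clS _ _] := spS.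
have [bU SUS USU SU] := group_inverseP spS.
rewrite /group_proper_splitting_converges; set U := group_inverse S in bU SUS USU SU *.
have SUSE x : S (U (S x)) = S x by exact: (congr1 (@^~ x) SUS).
have USUE x : U (S (U x)) = U x by exact: (congr1 (@^~ x) USU).
have SUE x : S (U x) = U (S x) by exact: (congr1 (@^~ x) SU).
have [lS _] := bS; have [lU _] := bU.
have rU : range U = range S.
  apply/seteqP; split=> _ [x _ <-].
    by exists (U (U x)) => //; rewrite SUE USUE.
  by exists (S (S x)) => //; rewrite -SUE SUSE.
have kU : Defs.kernel U = Defs.kernel S.
  apply/seteqP; split=> x; rewrite /Defs.kernel /= => x0.
    by rewrite -SUSE -SUE x0 !linear_0.
  by rewrite -USUE SUE x0 !linear_0.
have [[[bP PP] [_ Psa]] kP] := orth_proj_row_space bS clS.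
rewrite -/P in bP PP Psa kP; have [lP _] := bP.
have [] := moore_penroseP bU; first by rewrite rU.
set X := moore_penrose ip U => bX UXU _ _ [bXU XUsa].
have UXUE x : U (X (U x)) = U x by exact: (congr1 (@^~ x) UXU).
have [lX _] := bX.
(* Equality of kernels gives [U P = U] and [P X U = P]. The adjoint of [X U P = X U] is
   [P X U = X U], so [X U = P]. *)
have XU x : X (U x) = P x.
  have UP y : U (P y) = U y.
    apply/esym/eqP; rewrite -subr_eq0 -linear_sub//; apply/eqP.
    suff : Defs.kernel U (y - P y) by [].
    by rewrite kU -kP /Defs.kernel /= linear_sub// (congr1 (@^~ y) PP : P (P y) = _) subrr.
  have PXU y : P (X (U y)) = P y.
    apply/eqP; rewrite -subr_eq0 -linear_sub//; apply/eqP.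
    suff : Defs.kernel P (X (U y) - y) by [].
    by rewrite kP -kU /Defs.kernel /= linear_sub// UXUE subrr.
  apply: ip_inj => z.
  by rewrite -[RHS]Psa -(XUsa z x) /= -(UP z) (XUsa (P z) x) /= Psa PXU -Psa.
have XW x : X (U x - S x) = P x - P (S (S x)).
  by rewrite linear_sub// XU -{1}SUSE SUE XU.
split; last first.
  apply: (@le_lt_trans _ _ k%:E); last by rewrite lte_fin.
  apply: spectral_radius_le; first exact: bounded_comp bX (bounded_sub bU bS).
  by move=> x; have := Pk x; rewrite -XW.
split=> //; first exact: bounded_sub.
by apply/funext => x /=; rewrite subKr.
Qed.

(** Taking adjoints in [S^* = Q T^*] gives [S = T Q]. The given [Q] may differ from [P], but
    [x - Q x] lies in [N(S) = N(P)], so [P Q = P], hence [Q P = P] and [S = S P = T Q P = T P]. *)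
Lemma star_le_row_proj S T : bounded_operator S -> closed (range S) ->
  bounded_operator T -> star_le ip S T ->
  forall x, S x = T (orth_proj ip (range (adjoint ip S)) x).
Proof.
move=> bS clS bT [_ [Q [_ [[bQ QQ] [_ Qsa]] _ SaE]]].
have [lS _] := bS; have [lQ _] := bQ.
have [[[bP PP] [_ Psa]] kP] := orth_proj_row_space bS clS.
set P := orth_proj _ _ in bP PP Psa kP *; have [lP _] := bP.
have [_ adjS] := adjointP bS; have [_ adjT] := adjointP bT.
have STQ x : S x = T (Q x).
  apply/esym/ip_inj => z; rewrite ipC [RHS]ipC; congr (_^*%C).
  by rewrite adjS SaE adjT Qsa.
have PQ x : P (Q x) = P x.
  apply/esym/eqP; rewrite -subr_eq0 -linear_sub//; apply/eqP.
  suff : Defs.kernel P (x - Q x) by [].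
  by rewrite kP /Defs.kernel /= linear_sub// !STQ (congr1 (@^~ x) QQ : Q (Q x) = _) subrr.
have QP x : Q (P x) = P x.
  by apply: ip_inj => z; rewrite -Qsa -!Psa PQ.
have SP x : S (P x) = S x.
  apply/esym/eqP; rewrite -subr_eq0 -linear_sub//; apply/eqP.
  suff : Defs.kernel S (x - P x) by [].
  by rewrite -kP /Defs.kernel /= linear_sub// (congr1 (@^~ x) PP : P (P x) = _) subrr.
by move=> x; rewrite -SP STQ QP.
Qed.

(** In the nontrivial case [T x - Q (T x)] lies in [N(Q) = N(S)], while [Q (T x) = S x]. *)
Lemma sharp_le_mul S T : linear S -> sharp_le S T -> forall x, S (T x) = S (S x).
Proof.
move=> lS [<-//|[Q [[[lQ _] QQ] _ kQ SQT _]]] x.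
rewrite [in RHS](congr1 (@^~ x) SQT : S x = Q (T x)).
apply/eqP; rewrite -subr_eq0 -linear_sub//; apply/eqP.
suff : Defs.kernel S (T x - Q (T x)) by [].
by rewrite -kQ /Defs.kernel /= linear_sub// (congr1 (@^~ (T x)) QQ : Q (Q (T x)) = _) subrr.
Qed.

Lemma orthogonal_projection_le P : orthogonal_projection ip P ->
  forall x, rnorm (P x) <= rnorm x.
Proof.
move=> [[bP PP] [_ Psa]] x.
have [->|Px0] := eqVneq (rnorm (P x)) 0; first exact: rnorm_ge0.
have Px_gt0 : 0 < rnorm (P x) by rewrite lt_def Px0 rnorm_ge0.
rewrite -(ler_pM2r Px_gt0) -expr2 -rdotxx /rdot Psa.
rewrite (congr1 (@^~ x) PP : P (P x) = _); exact: rdot_le.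
Qed.

End hilbert_space.

Theorem proposition5p6 (R : realType) (H : completeNormedModType R[i])
    (ip : {dot H for Num.conj}) (ip_norm : hilbert_norm ip) (S T : H -> H)
    (splitS : split_operator S) (splitT : split_operator T)
    (normST : (operator_norm
      (orth_proj ip (range (adjoint ip S)) \o (idfun \- (S \o T)))%R < 1)%E) :
  (star_le ip S T -> group_proper_splitting_converges ip S) /\
  (sharp_le S T -> group_proper_splitting_converges ip S).
Proof.
have [bS clS _ _] := splitS; have [bT _ _ _] := splitT.
have [orthP _] := orth_proj_row_space ip_norm bS clS.
set P := orth_proj _ _ in normST orthP.
have [[bP PP] _] := orthP; have [lP _] := bP; have [lS _] := bS.
have PE x : P (P x) = P x by exact: (congr1 (@^~ x) PP).
have [|k k1 kP] := operator_norm_lt1 _ normST.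
  by case: (bounded_comp bP (bounded_sub bounded_id (bounded_comp bS bT))).
(* The bound by [k] allows [k < 0] when [H = 0], so the sign is read off from a nonzero vector; it
   serves to compare [k * rnorm (P x)] with [k * rnorm x]. *)
have k_ge0 (x : H) : x != 0 -> 0 <= k.
  move=> x0; rewrite -(@pmulr_lge0 _ (rnorm x)); last first.
    by rewrite lt_def rnorm_ge0 andbT; apply: contra_neq x0; exact: rnorm_eq0.
  exact: le_trans (rnorm_ge0 _) (kP x).
split=> [ST|ST]; apply: (group_splitting_converges ip_norm splitS k1) => x.
  have STP := star_le_row_proj ip_norm bS clS bT ST.
  (* Evaluating the bound at [P x] turns [T] into [T P = S]; the loss is only
     [rnorm (P x) <= rnorm x]. *)
  have := kP (P x); rewrite /= linear_sub// PE -STP => /le_trans; apply.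
  have [->|x0] := eqVneq x 0; first by rewrite linear_0.
  by rewrite ler_wpM2l ?(k_ge0 x)// (orthogonal_projection_le ip_norm).
by have := kP x; rewrite /= linear_sub// (sharp_le_mul lS ST).
Qed.
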